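(* Let $f_0\colon\mathbb{R}^n\to\mathbb{R}$, $F\colon\mathbb{R}^n\to\mathbb{R}^m$, $G\colon\mathbb{R}^\ell\to\mathbb{R}^p$ and $H\colon\mathbb{R}^\ell\to\mathbb{R}^m$ be twice continuously differentiable, let $D\subset\mathbb{R}^p$ be closed, and suppose that $C:=H(Q)$ with $Q:=\{z\in\mathbb{R}^\ell\mid G(z)\in D\}$ is closed. Consider the problem $\min\{f_0(x)\mid F(x)\in C\}$ and let $\bar x\in\mathbb{R}^n$ be feasible. Let $\Phi\colon\mathbb{R}^m\rightrightarrows\mathbb{R}^\ell$, $\Phi(y):=\{z\in\mathbb{R}^\ell\mid G(z)\in D,\ H(z)=y\}$, be inner semicompact and inner calm* at $F(\bar x)$ with respect to $C$. Assume that for each $u\in\mathbb{R}^n\setminus\{0\}$ satisfying $$\nabla F(\bar x)u\in\bigcup_{z\in\Phi(F(\bar x))}\{\nabla H(z)w\in\mathbb{R}^m\mid w\in\mathbb{R}^\ell,\ \nabla G(z)w\in T_D(G(z))\},\qquad\langle\nabla f_0(\bar x),u\rangle\le0,$$ there are $\alpha\ge0$ and a multiplier $\lambda\in\Lambda^\alpha(\bar x)$ such that, for each $z\in\Phi(F(\bar x))$ and $w\in\mathbb{R}^\ell$ satisfying $\nabla H(z)w=\nabla F(\bar x)u$, there is a multiplier $$\eta\in\Sigma(z,w,\lambda):=\{\eta\in\widehat N^p_D(G(z);\nabla G(z)w)\mid\nabla G(z)^\top\eta=\nabla H(z)^\top\lambda\}$$ such that $$\nabla^2_{xx}L^\alpha(\bar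 x,\lambda)(u,u)+\vartheta(z,w,\lambda,\eta)>0,$$ where $$\vartheta(z,w,\lambda,\eta):=\langle\eta,\nabla^2G(z)(w,w)\rangle-\langle\lambda,\nabla^2H(z)(w,w)\rangle+\mathrm{d}^2\delta_D(G(z);\eta)(\nabla G(z)w).$$ Then $\bar x$ is an essential local minimizer of second order for this problem.
   Context: For $\alpha\ge0$: $L^\alpha(x,\lambda):=\alpha f_0(x)+\langle\lambda,F(x)\rangle$ and $\Lambda^\alpha(\bar x):=\{\lambda\in\mathbb{R}^m\mid\nabla_xL^\alpha(\bar x,\lambda)=0\}$. For a twice differentiable vector map $G$, $\langle\eta,\nabla^2G(z)(w,w)\rangle:=\sum_i\eta_i\,w^\top\nabla^2G_i(z)w$; similarly $\nabla^2_{xx}L^\alpha(\bar x,\lambda)(u,u):=u^\top\nabla^2_{xx}L^\alpha(\bar x,\lambda)u$. $T_D(\bar y):=\{v\mid\exists t_k\downarrow0,\,v_k\to v\colon\bar y+t_kv_k\in D\ \forall k\}$. $\delta_D$ is the indicator function of $D$ ($0$ on $D$, $+\infty$ off $D$), and the second subderivative of $h$ at $\bar z$ (with $|h(\bar z)|<\infty$) for $z^*$ is $\mathrm{d}^2h(\bar z;z^* )(w):=\liminf_{t\downarrow0,\,w'\to w}\frac{h(\bar z+tw')-h(\bar z)-t\langle z^*,w'\rangle}{\frac12t^2}\in[-\infty,\infty]$. Directional proximal normal cone: for closed $D$, $\bar y\in D$, $v\in T_D(\bar y)$, let $\hat{\mathcal{N}}^p_D(\bar y;v)$ be the set of all $y^*$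 for which there is $\gamma>0$ such that for all $t_k\downarrow0$, $v_k\to v$ with $\bar y+t_kv_k\in D$ for all $k$, $\langle y^*,v_k\rangle\le\gamma t_k\|v_k\|^2$ holds for all sufficiently large $k$; then $\widehat N^p_D(\bar y;v):=\hat{\mathcal{N}}^p_D(\bar y;v)\cap\{y^*\mid\langle y^*,v\rangle=0\}$. If $v\notin T_D(\bar y)$, $\widehat N^p_D(\bar y;v):=\varnothing$. $\Phi$ is inner semicompact at $\bar y$ w.r.t. $C$ if for each sequence $y_k\to\bar y$ with $y_k\in C$ for all $k$ there exist $z\in\mathbb{R}^\ell$, a subsequence $y_{k_j}$, and $z_j\to z$ with $z_j\in\Phi(y_{k_j})$ for each $j$. $\Phi$ is inner calm* at $\bar y$ w.r.t. $C$ if there is $\kappa>0$ such that for each such sequence, $z$, the subsequence and $z_j\to z$ with $z_j\in\Phi(y_{k_j})$ can be chosen with, in addition, $\|z_j-z\|\le\kappa\|y_{k_j}-\bar y\|$ for each $j$. A point $\bar x$ is an essential local minimizer of second order for $\min\{f_0(x)\mid F(x)\in C\}$ if $F(\bar x)\in C$ and there exist $\varepsilon>0$ and $\delta>0$ such that $\max\{f_0(x)-f_0(\bar x),\operatorname{dist}(F(x),C)\}\ge\varepsilon\|x-\bar x\|^2$ for all $x$ with $\|x-\bar x\|\le\delta$. *)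

(* Defs.v *)
From HB Require Import structures.
From mathcomp Require Import all_boot all_order all_algebra.
From mathcomp Require Import all_classical all_reals all_analysis.

Set Implicit Arguments.
Unset Strict Implicit.
Unset Printing Implicit Defensive.

Import Order.TTheory GRing.Theory Num.Theory.
Import numFieldNormedType.Exports.

Local Open Scope classical_set_scope.
Local Open Scope ring_scope.

(* Built on MathComp-Analysis. Vectors are row vectors, so the library Jacobian
   ['J f x : 'M_(n, m)] is the transpose of the usual matrix: the image of [u]
   under the derivative is [u *m 'J f x], and the transposed derivative applied
   to [eta] is [eta *m ('J f x)^T]. *)

Section Euclidean.
Variables (R : realType) (n : nat).
Implicit Types (u v x : 'rV[R]_n) (f : 'rV[R]_n -> R).

Definition dot u v : R := \sum_i u 0 i * v 0 i.

(* The library norm on ['rV[R]_n] is the max norm; it induces the same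
   topology, but quantitative estimates below use this Euclidean norm. *)
Definition enorm u : R := Num.sqrt (dot u u).

(* A real-valued infimum, meaningful for nonempty [C] only. *)
Definition edistance x (C : set 'rV[R]_n) : R := inf [set enorm (x - c) | c in C].

Definition grad f x : 'rV[R]_n := \row_i 'D_(delta_mx 0 i) f x.

Definition hess f x : 'M[R]_n := 'J (grad f) x.

Definition quad (A : 'M[R]_n) u : R := dot (u *m A) u.

Definition C2 f : Prop :=
  [/\ forall x, differentiable f x,
      forall x, differentiable (grad f) x
    & continuous (hess f)].

End Euclidean.

Definition component (R : realType) (n m : nat) (f : 'rV[R]_n -> 'rV[R]_m)
  (i : 'I_m) : 'rV[R]_n -> R := fun x => f x 0 i.

Definition C2map (R : realType) (n m : nat) (f : 'rV[R]_n -> 'rV[R]_m) : Prop :=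
  forall i, C2 (component f i).

(* <eta, nabla^2 f(x)(w, w)> *)
Definition dot_hess (R : realType) (n m : nat) (eta : 'rV[R]_m)
    (f : 'rV[R]_n -> 'rV[R]_m) (x w : 'rV[R]_n) : R :=
  \sum_i eta 0 i * quad (hess (component f i) x) w.

Section VariationalGeometry.
Variables (R : realType) (p : nat).
Implicit Types (D : set 'rV[R]_p) (y v : 'rV[R]_p).

Definition feasible_steps D y v (t : nat -> R) (vs : nat -> 'rV[R]_p) : Prop :=
  [/\ forall k, 0 < t k, t @ \oo --> 0, vs @ \oo --> v
    & forall k, D (y + t k *: vs k)].

Definition tangent_cone D y : set 'rV[R]_p :=
  [set v | exists t vs, feasible_steps D y v t vs].

Definition pre_prox_normal D y v : set 'rV[R]_p :=
  [set ys | exists2 gamma : R, 0 < gamma &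
     forall t vs, feasible_steps D y v t vs ->
       \forall k \near \oo, dot ys (vs k) <= gamma * t k * enorm (vs k) ^+ 2].

(* Empty if [v] is not tangent. *)
Definition prox_normal D y v : set 'rV[R]_p :=
  [set ys | [/\ tangent_cone D y v, pre_prox_normal D y v ys & dot ys v = 0]].

Definition indicator D : 'rV[R]_p -> \bar R :=
  fun y => if y \in D then 0%E else +oo%E.

(* Only meaningful when [h y] is finite. *)
Definition second_subderivative (h : 'rV[R]_p -> \bar R) (y ys v : 'rV[R]_p) :
    \bar R :=
  limf_einf (fun tw : R * 'rV[R]_p =>
      (h (y + tw.1 *: tw.2)%R - h y - (tw.1 * dot ys tw.2)%R%:E)
        * ((2^-1 * tw.1 ^+ 2)^-1)%R%:E)%E
    (filter_prod 0^'+ (nbhs v)).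

End VariationalGeometry.

Section SetValuedMaps.
Variables (R : realType) (m l : nat).
Variables (Phi : 'rV[R]_m -> set 'rV[R]_l) (y : 'rV[R]_m) (C : set 'rV[R]_m).

Definition inner_semicompact : Prop :=
  forall ys : nat -> 'rV[R]_m, (forall k, C (ys k)) -> ys @ \oo --> y ->
  exists (z : 'rV[R]_l) (s : nat -> nat) (zs : nat -> 'rV[R]_l),
    [/\ {homo s : i j / (i < j)%N}, zs @ \oo --> z
      & forall j, Phi (ys (s j)) (zs j)].

Definition inner_calm_star : Prop :=
  exists2 kappa : R, 0 < kappa &
  forall ys : nat -> 'rV[R]_m, (forall k, C (ys k)) -> ys @ \oo --> y ->
  exists (z : 'rV[R]_l) (s : nat -> nat) (zs : nat -> 'rV[R]_l),
    [/\ {homo s : i j / (i < j)%N}, zs @ \oo --> z,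
        forall j, Phi (ys (s j)) (zs j)
      & forall j, enorm (zs j - z) <= kappa * enorm (ys (s j) - y)].

End SetValuedMaps.

Section Problem.
Variables (R : realType) (n m : nat).
Variables (f0 : 'rV[R]_n -> R) (F : 'rV[R]_n -> 'rV[R]_m).

Definition lagrangian (alpha : R) (lambda : 'rV[R]_m) : 'rV[R]_n -> R :=
  fun x => alpha * f0 x + dot lambda (F x).

Definition multipliers (alpha : R) (x : 'rV[R]_n) : set 'rV[R]_m :=
  [set lambda | grad (lagrangian alpha lambda) x = 0].

Definition essential_local_minimizer2 (C : set 'rV[R]_m) (xbar : 'rV[R]_n) :
    Prop :=
  C (F xbar) /\
  exists eps delta : R, [/\ 0 < eps, 0 < delta &
    forall x, enorm (x - xbar) <= delta ->
      eps * enorm (x - xbar) ^+ 2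
        <= Num.max (f0 x - f0 xbar) (edistance (F x) C)].

End Problem.

Section ImageSet.
Variables (R : realType) (m l p : nat).
Variables (G : 'rV[R]_l -> 'rV[R]_p) (H : 'rV[R]_l -> 'rV[R]_m).
Variable (D : set 'rV[R]_p).
Implicit Types (y lambda : 'rV[R]_m) (z w : 'rV[R]_l) (eta : 'rV[R]_p).

Definition preimage_set : set 'rV[R]_l := [set z | D (G z)].

Definition image_set : set 'rV[R]_m := H @` preimage_set.

Definition solution_map y : set 'rV[R]_l := [set z | D (G z) /\ H z = y].

Definition Sigma z w lambda : set 'rV[R]_p :=
  [set eta | prox_normal D (G z) (w *m 'J G z) eta
             /\ eta *m ('J G z)^T = lambda *m ('J H z)^T].

Definition vartheta z w lambda eta : \bar R :=
  ((dot_hess eta G z w)%:E - (dot_hess lambda H z w)%:E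
   + second_subderivative (indicator D) (G z) eta (w *m 'J G z))%E.

End ImageSet.

(* Main.v *)
Require Import Defs.
From HB Require Import structures.
From mathcomp Require Import all_boot all_order all_algebra.
From mathcomp Require Import all_classical all_reals all_analysis.
From mathcomp Require Import ring lra.

(** Suppose that [xbar] is not an essential local minimizer of second order.
    Then there are points [x_k -> xbar], different from [xbar], and [y_k] in
    [C] such that, with [t_k := |x_k - xbar|], both the positive part of
    [f0 x_k - f0 xbar] and [F x_k - y_k] are [o(t_k^2)]. Along a subsequence
    [h_k := (x_k - xbar) / t_k] converges to some [u != 0]
    ([not_essential_minimizer_seq]).

    Inner calmness* lifts the [y_k] to points [z_k = z + t_k w_k] with
    [G z_k] in [D], [H z_k = y_k], [H z = F xbar], and its linear estimate
    [|z_k - z| <= kappa |y_k - F xbar| = O(t_k)] keeps the [w_k] bounded, so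
    that they may be assumed to converge to some [w]
    ([inner_calm_star_lift]). First order expansions show that [u] is a
    critical direction, with [z] and [w] as witnesses.

    Take the multipliers [alpha], [lambda] for [u] and then [eta] for this
    pair [z], [w]. Add the second order expansions of the Lagrangian at [xbar]
    (whose gradient vanishes there) and of [eta . G] at [z], and subtract the
    one of [lambda . H] at [z]: the first order terms cancel because
    [eta] and [lambda] agree through the transposed derivatives of [G] and
    [H]. As [H z_k = y_k], what remains is
      [1/2 t_k^2 (q + <eta, G''(w, w)> - <lambda, H''(w, w)>)
         - <eta, G z_k - G z> <= o(t_k^2)],
    where [q] is the Hessian of the Lagrangian at [(u, u)]. The quantity
    [- 2 <eta, G z_k - G z> / t_k^2] is a difference quotient of the
    indicator function of [D], so asymptotically it is bounded below by the
    second subderivative ([second_subderivative_indicator_gt]). Hence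
    [q + vartheta <= 0], against the assumption. *)

Set Implicit Arguments.
Unset Strict Implicit.
Unset Printing Implicit Defensive.

Import Order.TTheory GRing.Theory Num.Theory.
Import numFieldNormedType.Exports.

Local Open Scope classical_set_scope.
Local Open Scope ring_scope.

(** * Row vectors: coordinates, inner product and the two norms *)

Lemma cvg_sum_ord (R : realType) n (u : 'I_n -> nat -> R) (l : 'I_n -> R) :
  (forall i, u i @ \oo --> l i) ->
  (fun k => \sum_i u i k) @ \oo --> \sum_i l i.
Proof.
elim: n u l => [|n IHn] u l ul.
  by under eq_fun do rewrite big_ord0; rewrite big_ord0; exact: cvg_cst.
under eq_fun do rewrite big_ord_recl; rewrite big_ord_recl.
by apply: cvgD => //; apply: IHn => i; exact: ul.
Qed.

Lemma cvg_coord (R : realType) n (u : nat -> 'rV[R]_n) (v : 'rV[R]_n) i :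
  u @ \oo --> v -> (fun k => u k 0 i) @ \oo --> v 0 i.
Proof.
by move=> uv; exact: (continuous_cvg _ (@coord_continuous R _ _ 0 i v)).
Qed.

Lemma ler_coord_norm (R : realType) n (v : 'rV[R]_n) i : `|v 0 i| <= `|v|.
Proof.
rewrite [leRHS]/Num.norm /= mx_normrE; apply/bigmax_geP; right => /=.
by exists (0, i).
Qed.

Lemma ler_norm_coord (R : realType) n (v : 'rV[R]_n) e : 0 <= e ->
  (forall i, `|v 0 i| <= e) -> `|v| <= e.
Proof.
move=> e0 ve; rewrite [leLHS]/Num.norm /= mx_normrE; apply/bigmax_leP; split=> //.
by case=> j i _ /=; rewrite ord1.
Qed.

Lemma cvg_rV (R : realType) n (u : nat -> 'rV[R]_n) (v : 'rV[R]_n) :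
  (forall i, (fun k => u k 0 i) @ \oo --> v 0 i) -> u @ \oo --> v.
Proof.
move=> uv; apply/cvgrPdist_le => e e0.
have : \forall k \near \oo, forall i, `|v 0 i - u k 0 i| <= e.
  by apply: filter_forall => i; by have /cvgrPdist_le/(_ e e0) := uv i.
apply: filterS => k uk; apply: ler_norm_coord; first exact: ltW.
by move=> i; rewrite !mxE.
Qed.

Lemma cvg_dot (R : realType) n (u v : nat -> 'rV[R]_n)
    (a b : 'rV[R]_n) :
  u @ \oo --> a -> v @ \oo --> b ->
  (fun k => dot (u k) (v k)) @ \oo --> dot a b.
Proof.
move=> ua vb; apply: cvg_sum_ord => i.
by apply: cvgM; exact: cvg_coord.
Qed.

Section DotProduct.
Context {R : realType} {n : nat}.
Implicit Types (u v w : 'rV[R]_n).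

Lemma dotDl u v w : dot (u + v) w = dot u w + dot v w.
Proof. by rewrite -big_split; apply: eq_bigr => i _; rewrite !mxE mulrDl. Qed.

Lemma dotC u v : dot u v = dot v u.
Proof. by apply: eq_bigr => i _; rewrite mulrC. Qed.

Lemma dotZl a u v : dot (a *: u) v = a * dot u v.
Proof. by rewrite mulr_sumr; apply: eq_bigr => i _; rewrite !mxE mulrA. Qed.

Lemma dotNl u v : dot (- u) v = - dot u v.
Proof. by rewrite -scaleN1r dotZl mulN1r. Qed.

Lemma dotBl u v w : dot (u - v) w = dot u w - dot v w.
Proof. by rewrite dotDl dotNl. Qed.

Lemma dotZr a u v : dot u (a *: v) = a * dot u v.
Proof. by rewrite dotC dotZl dotC. Qed.

Lemma dotBr u v w : dot u (v - w) = dot u v - dot u w.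
Proof. by rewrite ![dot u _]dotC dotBl. Qed.

Lemma dot0l u : dot 0 u = 0.
Proof. by rewrite -(scale0r 0) dotZl mul0r. Qed.

Lemma ler_norm_dot u v : `|dot u v| <= n%:R * (`|u| * `|v|).
Proof.
apply: le_trans (ler_norm_sum _ _ _) _.
rewrite mulr_natl -[X in _ *+ X]card_ord -sumr_const.
by apply: ler_sum => i _; rewrite normrM ler_pM// ler_coord_norm.
Qed.

Lemma dot_ge0 u : 0 <= dot u u.
Proof. by apply: sumr_ge0 => i _; rewrite -expr2 sqr_ge0. Qed.

Lemma sqr_enorm u : enorm u ^+ 2 = dot u u.
Proof. by rewrite sqr_sqrtr// dot_ge0. Qed.

Lemma enorm_ge0 u : 0 <= enorm u.
Proof. exact: sqrtr_ge0. Qed.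

Lemma ler_norm_enorm u : `|u| <= enorm u.
Proof.
apply: ler_norm_coord => [|i]; first exact: enorm_ge0.
rewrite -sqrtr_sqr ler_wsqrtr// /dot (bigD1 i)//= expr2 lerDl.
by apply: sumr_ge0 => j _; rewrite -expr2 sqr_ge0.
Qed.

(** Together with [ler_norm_enorm], this makes the Euclidean norm of the
    estimates interchangeable, up to a constant, with the max norm that
    carries the topology. *)
Lemma ler_sqr_enorm u : enorm u ^+ 2 <= n%:R * `|u| ^+ 2.
Proof.
by rewrite sqr_enorm expr2 (le_trans (ler_norm _))// ler_norm_dot.
Qed.

Lemma ler_enorm_norm u : enorm u <= n%:R * `|u|.
Proof.
rewrite -(@ler_pXn2r _ 2)// ?nnegrE ?enorm_ge0 ?mulr_ge0//.
rewrite (le_trans (ler_sqr_enorm u))// exprMn ler_wpM2r ?sqr_ge0//.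
by rewrite -natrX ler_nat -mulnn; case: (n) => // k; rewrite leq_pmull.
Qed.

End DotProduct.

Lemma dot_trmx (R : realType) n m (A : 'M[R]_(n, m)) u v :
  dot u (v *m A) = dot (u *m A^T) v.
Proof.
rewrite /dot; under eq_bigr do rewrite mxE mulr_sumr.
under [RHS]eq_bigr do rewrite mxE mulr_suml.
rewrite exchange_big; apply: eq_bigr => i _; apply: eq_bigr => j _.
by rewrite mxE mulrCA mulrC.
Qed.

(** * Subsequences *)

Lemma homo_ge_id (s : nat -> nat) :
  {homo s : i j / (i < j)%N} -> forall k, (k <= s k)%N.
Proof.
by move=> smono; elim=> // k IHk; apply: leq_ltn_trans IHk (smono _ _ _).
Qed.

Lemma cvg_subseq (T : topologicalType) (s : nat -> nat) (u : nat -> T) (l : T) :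
  {homo s : i j / (i < j)%N} -> u @ \oo --> l -> (u \o s) @ \oo --> l.
Proof.
move=> smono ul; apply: cvg_comp ul => A [N _ NA].
exists N => // k /= Nk; apply: NA => /=.
exact: leq_trans Nk (homo_ge_id smono k).
Qed.

(** The one-dimensional theorem is applied to one coordinate after the other;
    each new extraction preserves the limits found before. *)
Lemma bolzano_weierstrass_rV (R : realType) n (u : nat -> 'rV[R]_n) (M : R) :
  (forall k, `|u k| <= M) ->
  exists (s : nat -> nat) (v : 'rV[R]_n),
    {homo s : i j / (i < j)%N} /\ (u \o s) @ \oo --> v.
Proof.
move=> uM.
suff /(_ n (leqnn n)) [s smono us] : forall d, (d <= n)%N -> exists2 s : nat -> nat,
    {homo s : i j / (i < j)%N} &
    forall i : 'I_n, (i < d)%N -> cvgn (fun k => u (s k) 0 i).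
  exists s, (\row_i limn (fun k => u (s k) 0 i)); split=> //.
  by apply: cvg_rV => i; rewrite mxE; exact: us.
elim=> [|d IHd] dn; first by exists id.
have [s smono us] := IHd (ltnW dn).
have [|s' s'mono us'] := @bolzano_weierstrass R (fun k => u (s k) 0 (Ordinal dn)).
  exists M; split; first exact: num_real.
  move=> x Mx k _; apply: le_trans (ltW Mx).
  exact: le_trans (ler_coord_norm _ _) (uM _).
have s'homo : {homo s' : i j / (i < j)%N}.
  by move=> i j ij; rewrite (leqW_mono s'mono).
exists (s \o s') => [i j ij|i]; first exact/smono/s'homo.
rewrite ltnS leq_eqVlt => /orP[/eqP id|/us]; last first.
  by move=> /cvg_ex[l ul]; apply/cvg_ex; exists l; exact: cvg_subseq ul.
by have -> : i = Ordinal dn by exact: val_inj.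
Qed.

(** * Expansions along sequences of directions *)

Lemma differentiable_near (R : realType) (V W : normedModType R)
    (f : V -> W) x e :
  differentiable f x -> 0 < e ->
  \forall h \near 0, `|f (x + h) - f x - 'd f x h| <= e * `|h|.
Proof.
move=> df e0; near=> h.
rewrite (diff_locallyxC df) -[X in `|X|]addrA -opprD addrAC subrr add0r.
by near: h; exact: littleoP.
Unshelve. all: by end_near. Qed.

(** First order expansion for moving directions [h k]: the remainder is
    [o(t k |h k|)], and [|h k|] stays bounded. *)
Lemma cvg_diff_quotient (R : realType) (V W : normedModType R) (f : V -> W) x
    (t : nat -> R) (h : nat -> V) (v : V) :
  differentiable f x -> (forall k, 0 < t k) -> t @ \oo --> 0 -> h @ \oo --> v ->
  (fun k => (t k)^-1 *: (f (x + t k *: h k) - f x)) @ \oo --> 'd f x v.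
Proof.
move=> df t0 t_0 hv.
have th0 : (fun k => t k *: h k) @ \oo --> 0 by rewrite -(scale0r v); exact: cvgZ.
have hd : (fun k => 'd f x (h k)) @ \oo --> 'd f x v.
  by apply: continuous_cvg hv; exact: (diff_continuous df).
have hb : \forall k \near \oo, `|h k| <= `|v| + 1.
  by apply: (cvgr_le _ (cvg_norm hv)); rewrite ltrDl.
suff rem : (fun k => (t k)^-1 *: (f (x + t k *: h k) - f x - 'd f x (t k *: h k)))
    @ \oo --> 0.
  rewrite -[X in _ --> X]add0r.
  suff -> : (fun k => (t k)^-1 *: (f (x + t k *: h k) - f x)) =
      (fun k => (t k)^-1 *: (f (x + t k *: h k) - f x - 'd f x (t k *: h k)))
      \+ (fun k => 'd f x (h k)) by exact: cvgD.
  apply/funext => k /=; rewrite linearZ [in RHS]scalerBr scalerA mulVf ?gt_eqF//.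
  by rewrite scale1r subrK.
apply/cvgr0Pnorm_le => e e0.
have v1 : 0 < `|v| + 1 by rewrite ltr_wpDl.
have := th0 _ (differentiable_near df (divr_gt0 e0 v1)).
apply: filterS2 hb => k hk; rewrite /= /preimage /= => dk.
rewrite normrZ gtr0_norm ?invr_gt0// ler_pdivrMl//.
apply: le_trans dk _; rewrite normrZ gtr0_norm// mulrCA ler_wpM2l ?(ltW (t0 k))//.
by rewrite mulrAC ler_pdivrMr// ler_wpM2l// ltW.
Qed.

Lemma dot_grad (R : realType) n (f : 'rV[R]_n -> R) x h :
  differentiable f x -> dot (grad f x) h = 'd f x h.
Proof.
move=> df; rewrite [in RHS](row_sum_delta h) linear_sum; apply: eq_bigr => i _.
by rewrite linearZ /= mxE deriveE// mulrC.
Qed.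

Lemma quad_hess (R : realType) n (f : 'rV[R]_n -> R) x h :
  quad (hess f x) h = dot ('d (grad f) x h) h.
Proof. by rewrite /quad /hess /jacobian mul_rV_lin1. Qed.

Lemma differentiable_component (R : realType) n m (F : 'rV[R]_n -> 'rV[R]_m) x :
  (forall i, differentiable (component F i) x) -> differentiable F x.
Proof.
move=> dF.
have -> : F = \sum_(i < m) (fun y => component F i y *: delta_mx 0 i).
  by apply/funext => y; rewrite fct_sumE {1}(row_sum_delta (F y)).
by apply: differentiable_sum => i; exact: differentiableZl.
Qed.

Lemma diff_component (R : realType) n m (F : 'rV[R]_n -> 'rV[R]_m) x h i :
  (forall j, differentiable (component F j) x) ->
  'd (component F i) x h = (h *m 'J F x) 0 i.
Proof.
move=> dF; have dFx := differentiable_component dF.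
rewrite -deriveEjacobian// -deriveE// derive_mx ?mxE//.
exact: diff_derivable.
Qed.

Lemma is_derive_line (R : realType) n (f : 'rV[R]_n -> R) x h (s : R) :
  differentiable f (x + s *: h) ->
  is_derive s 1 (fun r => f (x + r *: h)) ('d f (x + s *: h) h).
Proof.
move=> df.
pose l1 : R -> 'rV[R]_n := fun r => r *: h.
have dl1 : differentiable l1 s by exact: differentiableZl.
have dl : differentiable (cst x + l1) s by exact: differentiableD.
have dfl : differentiable (f \o (cst x + l1)) s by exact: differentiable_comp.
apply: DeriveDef; first exact: (diff_derivable dfl).
have dl1E : 'd l1 s 1 = h by rewrite diffZl// diff_val scale1r.
have dlE : 'd (cst x + l1) s 1 = h.
  apply: etrans (congr1 (@^~ 1) (diffD (differentiable_cst x s) dl1)) _.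
  apply: etrans (congr2 +%R (congr1 (@^~ 1) (diff_cst x s)) dl1E) _.
  exact: add0r.
have dflE : 'd (f \o (cst x + l1)) s 1 = 'd f (x + s *: h) h.
  by rewrite (congr1 (@^~ 1) (diff_comp dl df)) /= dlE.
by rewrite -dflE -deriveE.
Qed.

(** Mean value theorem on [0, 1] for
    [s |-> f (x + s h) - s <grad f x, h> - s^2/2 <hess f x h, h>]. It expresses
    the second order remainder by the first order remainder of the gradient,
    so that differentiability of the gradient at the single point [x] controls
    it. *)
Lemma taylor2_mvt (R : realType) n (f : 'rV[R]_n -> R) x h :
  (forall y, differentiable f y) ->
  exists2 c : R, 0 <= c <= 1 &
    f (x + h) - f x - dot (grad f x) h - 2^-1 * quad (hess f x) h
    = dot (grad f (x + c *: h) - grad f x - 'd (grad f) x (c *: h)) h.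
Proof.
move=> df.
pose a := dot (grad f x) h; pose b := quad (hess f x) h.
pose g (s : R) : R := f (x + s *: h).
pose phi : R -> R := g - (a *: (id : R -> R)) - (2^-1 * b) *: ((id : R -> R) ^+ 2).
pose dphi (s : R) : R := 'd f (x + s *: h) h - a - b * s.
have phiE (s : R) : is_derive s 1 phi (dphi s).
  have dg : is_derive s 1 g ('d f (x + s *: h) h) by exact: is_derive_line.
  apply: is_derive_eq; rewrite /dphi.
  rewrite /GRing.scale /= expr1 !mulr1.
  by field.
have phiC : continuous phi.
  move=> s; apply: differentiable_continuous; apply/derivable1_diffP.
  exact: (@ex_derive _ _ _ _ _ _ _ (phiE s)).
have [c c01 phi01] :=
  MVT_segment ler01 (fun s _ => phiE s) (continuous_subspaceT phiC).
move: phi01.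
have -> : phi 1 = f (x + h) - a - 2^-1 * b.
  by rewrite /phi !fctE /g scale1r /GRing.scale /= expr1n !mulr1.
have -> : phi 0 = f x.
  by rewrite /phi !fctE /g scale0r addr0 /GRing.scale /= expr0n /= !mulr0 !subr0.
rewrite /dphi subr0 mulr1 => phi01.
exists c; first by move: c01; rewrite in_itv.
have -> : 'd (grad f) x (c *: h) = c *: 'd (grad f) x h by exact: linearZ.
rewrite 2!dotBl (dot_grad _ (df (x + c *: h))) dotZl -quad_hess.
by rewrite -/a -/b (mulrC c) -phi01; ring.
Qed.

(** Peano form of the second order expansion, for moving directions. By
    [taylor2_mvt] the remainder is at most
    [n |grad f (x + c t h) - grad f x - (grad f)' (c t h)| |t h|], and the
    gradient factor is [o(t |h|)]. *)
Lemma cvg_taylor2 (R : realType) n (f : 'rV[R]_n -> R) (x : 'rV[R]_n)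
    (t : nat -> R) (h : nat -> 'rV[R]_n) (v : 'rV[R]_n) :
  (forall y, differentiable f y) -> differentiable (grad f) x ->
  (forall k, 0 < t k) -> t @ \oo --> 0 -> h @ \oo --> v ->
  (fun k => (t k ^+ 2)^-1
     * (f (x + t k *: h k) - f x - t k * dot (grad f x) (h k)))
    @ \oo --> 2^-1 * quad (hess f x) v.
Proof.
move=> df dg t0 t_0 hv.
have th0 : (fun k => `|t k *: h k|) @ \oo --> (0 : R).
  rewrite -[X in _ --> X](@normr0 _ 'rV[R]_n).
  by apply: cvg_norm; rewrite -(scale0r v); exact: cvgZ.
have hb : \forall k \near \oo, `|h k| <= `|v| + 1.
  by apply: (cvgr_le _ (cvg_norm hv)); rewrite ltrDl.
have main : (fun k => 2^-1 * quad (hess f x) (h k)) @ \oo -->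
    2^-1 * quad (hess f x) v.
  apply: cvgM; first exact: cvg_cst.
  under eq_fun do rewrite quad_hess; rewrite quad_hess.
  apply: cvg_dot => //.
  by apply: continuous_cvg hv; exact: (diff_continuous dg).
rewrite -[X in _ --> X]addr0.
suff rem : (fun k => (t k ^+ 2)^-1 * (f (x + t k *: h k) - f x
      - t k * dot (grad f x) (h k) - 2^-1 * quad (hess f x) (t k *: h k)))
    @ \oo --> 0.
  rewrite (_ : (fun k => _) = (fun k => 2^-1 * quad (hess f x) (h k)) \+
      (fun k => (t k ^+ 2)^-1 * (f (x + t k *: h k) - f x
        - t k * dot (grad f x) (h k) - 2^-1 * quad (hess f x) (t k *: h k)))).
    exact: cvgD.
  apply/funext => k /=; rewrite !quad_hess.
  have -> : 'd (grad f) x (t k *: h k) = t k *: 'd (grad f) x (h k).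
    exact: linearZ.
  rewrite dotZl dotZr.
  have := t0 k; set a := dot _ (h k); set b := dot _ (h k) => tk0.
  by field; rewrite gt_eqF.
apply/cvgr0Pnorm_le => e e0.
(* [n] comes from [ler_norm_dot]; its successor keeps the constant nonzero in
   dimension [0]. *)
pose K : R := n.+1%:R * (`|v| + 1) ^+ 2.
have v1 : 0 < `|v| + 1 by rewrite ltr_wpDl.
have K0 : 0 < K by rewrite mulr_gt0// exprn_gt0.
have /nbhs_norm0P[d d0 dE] := differentiable_near dg (divr_gt0 e0 K0).
have thd : \forall k \near \oo, `|t k *: h k| < d by exact: (cvgr_lt _ th0).
apply: filterS2 hb thd => k hk thk.
have [c /andP[c0 c1] E] := taylor2_mvt x (t k *: h k) df.
rewrite -dotZr E normrM normfV (ger0_norm (sqr_ge0 (t k))).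
rewrite ler_pdivrMl ?exprn_gt0//.
have cth : `|c *: (t k *: h k)| <= `|t k *: h k|.
  by rewrite normrZ ger0_norm// ler_piMl.
apply: le_trans (ler_norm_dot _ _) _.
have {}dE := le_trans (dE _ (le_lt_trans cth thk))
  (ler_wpM2l (ltW (divr_gt0 e0 K0)) cth).
apply: (@le_trans _ _ (n.+1%:R * (e / K * `|t k *: h k| * `|t k *: h k|))).
  by apply: ler_pM => //; rewrite ?ler_nat ?leqnSn ?mulr_ge0// ler_wpM2r.
rewrite normrZ (gtr0_norm (t0 k)).
rewrite [leLHS](_ : _ = t k ^+ 2 * (e * (n.+1%:R * `|h k| ^+ 2 / K))); last first.
  by field; rewrite gt_eqF.
rewrite ler_wpM2l ?exprn_ge0 ?(ltW (t0 k))// ler_piMr ?(ltW e0)//.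
by rewrite ler_pdivrMr// mul1r ler_wpM2l// lerXn2r ?nnegrE ?(ltW v1).
Qed.

(** * The Lagrangian and scalarized maps *)

(** Differentiability of the gradient is asked at [x] only: this is what the
    second order expansion needs. *)
Definition twice_differentiable (R : realType) n (f : 'rV[R]_n -> R) x :=
  (forall y, differentiable f y) /\ differentiable (grad f) x.

Lemma twice_differentiableD (R : realType) n (f g : 'rV[R]_n -> R) x :
  twice_differentiable f x -> twice_differentiable g x ->
  twice_differentiable (f + g) x.
Proof.
move=> [df df2] [dg dg2]; split=> [y|]; first exact: differentiableD.
suff -> : grad (f + g) = grad f + grad g by exact: differentiableD.
apply/funext => y; apply/rowP => i; rewrite !mxE.
by rewrite deriveD//; exact: diff_derivable.
Qed.

Lemma twice_differentiableZ (R : realType) n a (f : 'rV[R]_n -> R) x :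
  twice_differentiable f x -> twice_differentiable (a *: f) x.
Proof.
move=> [df df2]; split=> [y|]; first exact: differentiableZ.
suff -> : grad (a *: f) = a *: grad f by exact: differentiableZ.
apply/funext => y; apply/rowP => i; rewrite !mxE.
by rewrite deriveZ//; exact: diff_derivable.
Qed.

Lemma twice_differentiable0 (R : realType) n (x : 'rV[R]_n) :
  twice_differentiable (0 : 'rV[R]_n -> R) x.
Proof.
split=> [y|]; first exact: differentiable_cst.
suff -> : grad (0 : 'rV[R]_n -> R) = cst 0 by exact: differentiable_cst.
by apply/funext => y; apply/rowP => i; rewrite !mxE derive_cst.
Qed.

Lemma twice_differentiable_lagrangian (R : realType) n m (f0 : 'rV[R]_n -> R)
    (F : 'rV[R]_n -> 'rV[R]_m) alpha lambda x :
  C2 f0 -> C2map F -> twice_differentiable (lagrangian f0 F alpha lambda) x.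
Proof.
move=> [df0 ddf0 _] C2F.
have -> : lagrangian f0 F alpha lambda =
    alpha *: f0 + \sum_i lambda 0 i *: component F i.
  by apply/funext => y; rewrite /lagrangian fctE fct_sumE.
apply: twice_differentiableD; first by apply: twice_differentiableZ; split.
elim/big_ind : _ => [|f g|i _]; first exact: twice_differentiable0.
  exact: twice_differentiableD.
by apply: twice_differentiableZ; have [dF ddF _] := C2F i; split.
Qed.

(** The first order part is left as [eta] against the image of [h k] under
    the Jacobian, the form in which the multiplier equation of [Sigma]
    matches the parts belonging to [G] and [H]. *)
Lemma cvg_taylor2_dot (R : realType) n m (G : 'rV[R]_n -> 'rV[R]_m)
    (eta : 'rV[R]_m) (x : 'rV[R]_n) (t : nat -> R) (h : nat -> 'rV[R]_n)
    (v : 'rV[R]_n) :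
  C2map G -> (forall k, 0 < t k) -> t @ \oo --> 0 -> h @ \oo --> v ->
  (fun k => (t k ^+ 2)^-1 * (dot eta (G (x + t k *: h k) - G x)
     - t k * dot eta (h k *m 'J G x))) @ \oo --> 2^-1 * dot_hess eta G x v.
Proof.
move=> C2G t0 t_0 hv.
have dG i y : differentiable (component G i) y by have [] := C2G i.
rewrite (_ : (fun k => _) = (fun k => \sum_i eta 0 i *
    ((t k ^+ 2)^-1 * (component G i (x + t k *: h k) - component G i x
       - t k * dot (grad (component G i) x) (h k))))); last first.
  apply/funext => k; rewrite /dot [t k * _]mulr_sumr -sumrB mulr_sumr.
  apply: eq_bigr => i _; rewrite -/(dot _ _) dot_grad// diff_component//.
  by rewrite !mxE /component; ring.
rewrite /dot_hess mulr_sumr; apply: cvg_sum_ord => i; rewrite mulrCA.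
apply: cvgM; first exact: cvg_cst.
by apply: cvg_taylor2 => //; have [] := C2G i.
Qed.

(** * Second subderivative of an indicator function *)

(** Along steps that stay in [D] the indicator vanishes, and its second order
    difference quotient is just [- 2 <ys, vs k> / t k]. A strict real lower
    bound of the lower limit leaves room for a slightly larger constant, which
    bounds the quotient eventually along every such sequence. *)
Lemma second_subderivative_indicator_gt (R : realType) p (D : set 'rV[R]_p)
    y ys v t vs (c : R) :
  D y -> feasible_steps D y v t vs ->
  (c%:E < second_subderivative (indicator D) y ys v)%E ->
  exists2 c' : R, c < c' &
    \forall k \near \oo, c' <= - 2 * ((t k)^-1 * dot ys (vs k)).
Proof.
move=> Dy [t0 t_0 vsv Dt]; rewrite /second_subderivative limf_einfE.
move=> /ereal_sup_gt[_ [V FV <-]]; set I := ereal_inf _ => cI.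
(* The infimum may be infinite, but only a real lower bound is wanted. *)
have [c' cc' c'I] : exists2 c' : R, c < c' & (c'%:E <= I)%E.
  case: I cI => [r| |] //.
    by rewrite lte_fin => cr; exists r => //; exact: lexx.
  by move=> _; exists (c + 1); rewrite ?ltrDl// leey.
exists c' => //.
have t_0r : t @ \oo --> 0^'+.
  move=> A /= /t_0; rewrite !nbhs_filterE /=.
  by apply: (@filterS _ \oo) => k; apply.
have tv : (fun k => (t k, vs k)) @ \oo --> filter_prod 0^'+ (nbhs v).
  exact: (cvg_pair t_0r vsv).
have tvV : \forall k \near \oo, V (t k, vs k) by exact: tv _ FV.
apply: filterS tvV => k Vk.
have := le_trans c'I (ereal_inf_lbound (imageP _ Vk)).
rewrite /indicator /= !mem_set// -!EFinB -EFinM lee_fin !sub0r oppr0 add0r.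
suff -> : - (t k * dot ys (vs k)) * (2^-1 * t k ^+ 2)^-1 =
  - 2 * ((t k)^-1 * dot ys (vs k)) by [].
have := t0 k; set a := dot _ _ => tk0.
by field; rewrite gt_eqF.
Qed.

(** * Sequences violating quadratic growth *)

(** Quadratic growth is denied with [eps = delta = 1 / (k + 1)]; the bound on
    the distance to [C] is turned into a point of [C], and directions are
    normalized in the max norm. The factor [n] relating the two norms is
    absorbed in [a]. *)
Lemma not_essential_minimizer_seq (R : realType) n m (f0 : 'rV[R]_n -> R)
    (F : 'rV[R]_n -> 'rV[R]_m) (C : set 'rV[R]_m) xbar :
  C (F xbar) -> ~ essential_local_minimizer2 f0 F C xbar ->
  exists (t : nat -> R) (h : nat -> 'rV[R]_n) (ys : nat -> 'rV[R]_m)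
      (a : nat -> R) (u : 'rV[R]_n),
    [/\ u != 0, forall k, 0 < t k, t @ \oo --> 0 & h @ \oo --> u] /\
    [/\ forall k, C (ys k),
        forall k, (t k ^+ 2)^-1 * (f0 (xbar + t k *: h k) - f0 xbar) <= a k,
        a @ \oo --> 0
      & (fun k => (t k ^+ 2)^-1 *: (F (xbar + t k *: h k) - ys k)) @ \oo -->
          (0 : 'rV[R]_m)].
Proof.
move=> CF nmin.
have bad k : exists xy : 'rV[R]_n * 'rV[R]_m,
    [/\ 0 < `|xy.1 - xbar|, `|xy.1 - xbar| <= harmonic k, C xy.2,
      f0 xy.1 - f0 xbar <= harmonic k * (n%:R * `|xy.1 - xbar| ^+ 2)
    & `|F xy.1 - xy.2| <= harmonic k * (n%:R * `|xy.1 - xbar| ^+ 2)].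
  have e0 := @harmonic_gt0 R k; set e : R := harmonic k in e0 *.
  apply: contrapT => nbad; apply: nmin; split=> //; exists e, e; split=> // x xe.
  rewrite leNgt; apply/negP; rewrite gt_max => /andP[fx /inf_lt].
  case; first by exists (enorm (F x - F xbar)); exists (F xbar).
  move=> _ [y Cy <-] yx; apply: nbad; exists (x, y) => /=.
  have ex : e * enorm (x - xbar) ^+ 2 <= e * (n%:R * `|x - xbar| ^+ 2).
    by rewrite ler_wpM2l ?ler_sqr_enorm ?ltW.
  split=> //.
  (* At [xbar] the bound on the distance would be [0], while it is strict. *)
  - rewrite normr_gt0; apply/negP => /eqP xx; move: yx.
    by rewrite xx sqr_enorm dot0l mulr0 ltNge enorm_ge0.
  - exact: le_trans (ler_norm_enorm _) xe.
  - exact: le_trans (ltW fx) ex.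
  - exact: le_trans (ler_norm_enorm _) (le_trans (ltW yx) ex).
have [xy /all_and5[x0 xe Cy fx Fx]] := choice bad.
pose t0 k := `|(xy k).1 - xbar|.
pose h0 k := (t0 k)^-1 *: ((xy k).1 - xbar).
have h01 k : `|h0 k| = 1.
  by rewrite normrZ -/(t0 k) normfV ger0_norm ?normr_ge0// mulVf// gt_eqF// x0.
have xE k : xbar + t0 k *: h0 k = (xy k).1.
  by rewrite scalerA divff ?scale1r ?gt_eqF// ?x0// addrC subrK.
have [|s [u [smono hu]]] := @bolzano_weierstrass_rV R n h0 1.
  by move=> k; rewrite h01.
have hs : (@harmonic R \o s) @ \oo --> 0.
  exact: (cvg_subseq smono (@cvg_harmonic R)).
have as0 : (fun k => harmonic (s k) * n%:R : R) @ \oo --> 0.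
  by rewrite -[X in _ --> X](mul0r n%:R); apply: cvgM => //; exact: cvg_cst.
exists (t0 \o s), (h0 \o s), (fun k => (xy (s k)).2),
  (fun k => harmonic (s k) * n%:R), u.
split; split=> //=.
- have hu1 : (fun k => `|(h0 \o s) k|) @ \oo --> (1 : R).
    by under eq_fun do rewrite /= h01; exact: cvg_cst.
  have u1 : `|u| = 1 := cvg_unique (@norm_hausdorff _ _) (cvg_norm hu) hu1.
  by rewrite -normr_gt0 u1.
- move=> k; exact: x0.
- apply: (squeeze_cvgr _ (cvg_cst 0) hs); near=> k.
  by rewrite normr_ge0 xe.
- move=> k; rewrite xE ler_pdivrMl ?exprn_gt0//; last exact: x0.
  by apply: le_trans (fx _) _; rewrite mulrA mulrC.
- apply/cvgr0Pnorm_le => e e0.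
  have /cvgr0Pnorm_le/(_ e e0) := as0; apply: filterS => k ak.
  rewrite xE normrZ normfV (ger0_norm (sqr_ge0 _)).
  rewrite ler_pdivrMl ?exprn_gt0//; last exact: x0.
  apply: le_trans (Fx _) _; rewrite mulrA mulrC ler_wpM2l ?sqr_ge0//.
  exact: le_trans (ler_norm _) ak.
Unshelve. all: by end_near. Qed.

(** The linear estimate in inner calmness* is what bounds the directions
    [(zs j - z) / t], because [ys k - ybar] is of order [t k]. *)
Lemma inner_calm_star_lift (R : realType) m l p (G : 'rV[R]_l -> 'rV[R]_p)
    (H : 'rV[R]_l -> 'rV[R]_m) (D : set 'rV[R]_p) (ybar v : 'rV[R]_m)
    (t : nat -> R) (ys : nat -> 'rV[R]_m) :
  continuous G -> continuous H -> closed D ->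
  inner_calm_star (solution_map G H D) ybar (image_set G H D) ->
  (forall k, 0 < t k) -> t @ \oo --> 0 -> (forall k, image_set G H D (ys k)) ->
  (fun k => (t k)^-1 *: (ys k - ybar)) @ \oo --> v ->
  exists (s : nat -> nat) (z w : 'rV[R]_l) (ws : nat -> 'rV[R]_l),
    [/\ {homo s : i j / (i < j)%N}, ws @ \oo --> w,
        solution_map G H D ybar z
      & forall j, solution_map G H D (ys (s j)) (z + t (s j) *: ws j)].
Proof.
move=> cG cH cD [kappa kappa0 calm] t0 t_0 Cy yv.
have tn0 k : t k != 0 by rewrite gt_eqF.
have yE k : ys k = ybar + t k *: ((t k)^-1 *: (ys k - ybar)).
  by rewrite scalerA divff// scale1r addrC subrK.
have ycvg : ys @ \oo --> ybar.
  rewrite (_ : ys = cst ybar \+ (fun k => t k *: ((t k)^-1 *: (ys k - ybar)))).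
    rewrite -[X in _ --> X]addr0 -[X in _ + X](scale0r v).
    by apply: cvgD; [exact: cvg_cst|exact: cvgZ].
  by apply/funext => k; rewrite {1}yE.
have [z [s1 [zs [s1mono zcvg zsol zle]]]] := calm ys Cy ycvg.
have zbar : solution_map G H D ybar z.
  split.
    have Gz : (G \o zs) @ \oo --> G z by exact: (continuous_cvg _ (cG z) zcvg).
    by apply: (closed_cvg D cD _ _ Gz); apply: nearW => j; exact: (zsol j).1.
  have Hz : (H \o zs) @ \oo --> H z by exact: (continuous_cvg _ (cH z) zcvg).
  apply: (cvg_unique (@norm_hausdorff _ _) Hz).
  rewrite (_ : H \o zs = ys \o s1); first exact: cvg_subseq.
  by apply/funext => j /=; have [] := zsol j.
pose ws0 j := (t (s1 j))^-1 *: (zs j - z).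
have /cvg_seq_bounded[M [_ /(_ (M + 1))]] : cvgn (fun k => (t k)^-1 *: (ys k - ybar)).
  by apply/cvg_ex; exists v.
rewrite ltrDl ltr01 => /(_ isT) yM.
have [|s2 [w [s2mono wcvg]]] := @bolzano_weierstrass_rV R l ws0
    (kappa * (m%:R * (M + 1))).
  move=> j; rewrite /ws0 normrZ gtr0_norm ?invr_gt0// ler_pdivrMl//.
  apply: le_trans (ler_norm_enorm _) _; apply: le_trans (zle j) _.
  rewrite mulrCA ler_wpM2l ?(ltW kappa0)//.
  apply: le_trans (ler_enorm_norm _) _; rewrite mulrCA ler_wpM2l//.
  rewrite -ler_pdivrMl//; have /= := yM (s1 j) I.
  by rewrite normrZ gtr0_norm ?invr_gt0.
exists (s1 \o s2), z, w, (ws0 \o s2); split=> //.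
  by move=> i j ij; exact/s1mono/s2mono.
move=> j; rewrite /ws0 /= scalerA divff// scale1r addrC subrK.
exact: zsol.
Qed.

(** * Second order sufficient condition *)

Theorem theorem5p10 (R : realType) (n m l p : nat)
    (f0 : 'rV[R]_n -> R) (F : 'rV[R]_n -> 'rV[R]_m)
    (G : 'rV[R]_l -> 'rV[R]_p) (H : 'rV[R]_l -> 'rV[R]_m)
    (D : set 'rV[R]_p) (xbar : 'rV[R]_n)
    (C2f0 : C2 f0) (C2F : C2map F) (C2G : C2map G) (C2H : C2map H)
    (closedD : closed D)
    (closedC : closed (image_set G H D))
    (feasible : image_set G H D (F xbar))
    (semicompact :
       inner_semicompact (solution_map G H D) (F xbar) (image_set G H D))
    (calm : inner_calm_star (solution_map G H D) (F xbar) (image_set G H D))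
    (second_order : forall u : 'rV[R]_n, u != 0 ->
       (\bigcup_(z in solution_map G H D (F xbar))
          [set w *m 'J H z | w in [set w | tangent_cone D (G z) (w *m 'J G z)]])
         (u *m 'J F xbar) ->
       dot (grad f0 xbar) u <= 0 ->
       exists alpha : R, 0 <= alpha /\
       exists lambda : 'rV[R]_m, multipliers f0 F alpha xbar lambda /\
       forall z w : 'rV[R]_l, solution_map G H D (F xbar) z ->
         w *m 'J H z = u *m 'J F xbar ->
         exists eta : 'rV[R]_p, Sigma G H D z w lambda eta /\
           (0 < (quad (hess (lagrangian f0 F alpha lambda) xbar) u)%:E
                + vartheta G H D z w lambda eta)%E) :
  essential_local_minimizer2 f0 F (image_set G H D) xbar.
Proof.
have dF x i : differentiable (component F i) x by have [] := C2F i.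
have dG z i : differentiable (component G i) z by have [] := C2G i.
have dH z i : differentiable (component H i) z by have [] := C2H i.
have df0 : differentiable f0 xbar by have [] := C2f0.
have cG : continuous G.
  by move=> z; apply: differentiable_continuous; exact: differentiable_component.
have cH : continuous H.
  by move=> z; apply: differentiable_continuous; exact: differentiable_component.
have F1 := differentiable_component (dF xbar).
apply: contrapT => /(not_essential_minimizer_seq feasible).
move=> [t [h [ys [a [u [[u0 t0 t_0 hu] [Cy fa a_0 Fy]]]]]]].
have tn0 k : t k != 0 by rewrite gt_eqF.
(* [ys] differs from [F] along the sequence by [o(t^2)] only, so that both have
   the same derivative in the direction [u]. *)
have yu : (fun k => (t k)^-1 *: (ys k - F xbar)) @ \oo --> u *m 'J F xbar.
  rewrite mul_rV_lin1 -[X in _ --> X]subr0 -[X in _ - X](scale0r 0).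
  rewrite (_ : (fun k => _) = (fun k => (t k)^-1 *: (F (xbar + t k *: h k) - F xbar))
      \- (fun k => t k *: ((t k ^+ 2)^-1 *: (F (xbar + t k *: h k) - ys k)))).
    by apply: cvgB; [exact: cvg_diff_quotient|exact: cvgZ].
  apply/funext => k /=; rewrite scalerA expr2 invfM mulVKf// -scalerBr.
  by rewrite opprB [X in _ = _ *: X]addrC addrA subrK.
have [s [z [w [ws [smono wsw [Dz Hz] zsol]]]]] :=
  inner_calm_star_lift cG cH closedD calm t0 t_0 Cy yu.
have G1 := differentiable_component (dG z).
have H1 := differentiable_component (dH z).
have ts0 k : 0 < (t \o s) k by exact: t0.
have ts_0 : (t \o s) @ \oo --> 0 by exact: cvg_subseq.
have hsu : (h \o s) @ \oo --> u by exact: cvg_subseq.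
pose vs j := (t (s j))^-1 *: (G (z + t (s j) *: ws j) - G z).
have feas : feasible_steps D (G z) (w *m 'J G z) (t \o s) vs.
  split=> //; first by rewrite mul_rV_lin1; exact: (cvg_diff_quotient G1 ts0 ts_0 wsw).
  move=> j; rewrite /= scalerA divff// scale1r addrC subrK.
  by have [] := zsol j.
have wu : w *m 'J H z = u *m 'J F xbar.
  have Hw := cvg_diff_quotient H1 ts0 ts_0 wsw.
  rewrite [LHS]mul_rV_lin1; apply: (cvg_unique (@norm_hausdorff _ _) Hw).
  rewrite (_ : (fun k => _) = (fun k => (t k)^-1 *: (ys k - F xbar)) \o s).
    exact: cvg_subseq yu.
  by apply/funext => j /=; rewrite (zsol j).2 Hz.
have f0u : dot (grad f0 xbar) u <= 0.
  rewrite dot_grad//.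
  apply: (ler_cvg_to (cvg_diff_quotient df0 t0 t_0 hu) (g := fun k => t k * a k)).
    by rewrite -(mul0r 0); exact: cvgM.
  apply: nearW => k; rewrite -ler_pdivrMl//; apply: le_trans (fa k).
  by rewrite expr2 invfM -mulrA.
have crit : (\bigcup_(z in solution_map G H D (F xbar))
   [set w *m 'J H z | w in [set w | tangent_cone D (G z) (w *m 'J G z)]])
   (u *m 'J F xbar).
  by exists z => //; exists w => //; exists (t \o s), vs.
(* The multipliers are first chosen for [u], and [eta] only then for the pair
   [(z, w)] produced by the same sequence. *)
have [alpha [alpha0 [lambda [gradL mult]]]] := second_order u u0 crit f0u.
have [eta [[_ etaE] pos]] := mult z w (conj Dz Hz) wu.
set L := lagrangian f0 F alpha lambda in gradL pos.
set q := quad _ _ in pos.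
move: pos; rewrite /vartheta.
set dg := dot_hess eta G z w; set dh := dot_hess lambda H z w.
set S := second_subderivative _ _ _ _ => pos.
have /(second_subderivative_indicator_gt Dz feas)[c' cc' quot] :
    ((- (q + dg - dh))%:E < S)%E.
  case: S pos => [r| |] //=; rewrite ?ltry//.
  by rewrite -EFinB -!EFinD !lte_fin; lra.
have [dL dL2] := twice_differentiable_lagrangian alpha lambda xbar C2f0 C2F.
have limL := cvg_taylor2 dL dL2 ts0 ts_0 hsu.
have limG := @cvg_taylor2_dot R l p G eta z _ _ _ C2G ts0 ts_0 wsw.
have limH := @cvg_taylor2_dot R l m H lambda z _ _ _ C2H ts0 ts_0 wsw.
have lim0 : (fun j => alpha * a (s j) + dot lambda ((t (s j) ^+ 2)^-1 *:
    (F (xbar + t (s j) *: h (s j)) - ys (s j)))) @ \oo --> 0.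
  rewrite -[X in _ --> X]addr0 -[X in _ --> X + _](mulr0 alpha).
  rewrite -[X in _ --> _ + X](dot0l lambda) dotC.
  apply: cvgD.
    by apply: cvgM; [exact: cvg_cst|exact: (cvg_subseq smono a_0)].
  apply: cvg_dot; first exact: cvg_cst.
  exact: (cvg_subseq smono Fy).
have := ler_cvg_to (cvgD (cvgB (cvgD limL limG) limH) (cvg_cst (2^-1 * c'))) lim0.
rewrite -/q -/dg -/dh => lim_le.
(* The difference quotient of the indicator is replaced by its bound [c'], since
   it need not converge. *)
suff : 2^-1 * q + 2^-1 * dg - 2^-1 * dh + 2^-1 * c' <= 0 by lra.
apply: lim_le; apply: filterS quot => j.
have := fa (s j); rewrite !fctE /= (gradL : grad L xbar = 0) dot0l.
(* Both first order terms become the same number [K]: this is the equation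
   defining [Sigma]. *)
rewrite /vs (zsol j).2 Hz !dot_trmx etaE /L /lagrangian.
rewrite !dotZr !dotBr.
have := ts0 j; rewrite /= => tj0.
set A := f0 _; set A0 := f0 _; set B := dot lambda _; set B0 := dot lambda _.
set E := dot eta _; set E0 := dot eta _; set Y := dot lambda _; set K := dot _ (ws j).
move=> fA quotj.
have := ler_wpM2l alpha0 fA; lra.
Qed.
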